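(* Let $\mathcal X\times\mathcal U\subseteq\mathbb R^n\times\mathbb R^m$ be a neighborhood of the origin and let $f:\mathcal X\times\mathcal U\to\mathbb R^n$ be continuous with $f(0,0)=0$. Suppose that the control system $\dot x=f(x,u)$ has the origin as an isolated equilibrium. Then the system is locally asymptotically stabilizable by means of a composition operator $T_h$ with a stationary symbol $h$ which is continuous at the origin if and only if $f$ satisfies Brockett's condition, i.e. $f$ is open at $(0,0)$.
   Context: The origin is an isolated equilibrium of $\dot x=f(x,u)$ if there is a neighborhood of $(0,0)$ in $\mathcal X\times\mathcal U$ in which $f(x,u)=0$ has only the solution $(x,u)=(0,0)$. $f$ is open at a point $\bar z$ if $f(\bar z)\in\operatorname{int} f(\mathcal V)$ for every neighborhood $\mathcal V$ of $\bar z$. For a neighborhood of the origin $\mathcal O\subseteq\mathcal X$ and a map $h:\mathcal O\to\mathcal X\times\mathcal U$ (no continuity required unless stated), the composition operator $T_h$ with symbol $h$ is defined by $T_hf:=f\circ h$. The system $\dot x=f(x,u)$ is locally asymptotically stabilizable by means of a composition operator $T_h$ if there are such an $\mathcal O$ and $h$ for which the origin is a locally asymptotically stable equilibrium of $\dot x=T_hf(x)$. The symbol is stationary if $h(0)=(0,0)$. Standing assumption (uniqueness criterion): a stabilizing composition operator $T_h$ is always required to be such that $T_hf$ is continuous and $\dot x=T_hf(x)$ has a unique solution $x(t)$ for all $t\ge0$ and all initial states $x_0$ in a neighborhood of the origin. *)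

(* Defs.v *)
From mathcomp Require Import all_boot all_order all_algebra.
From mathcomp Require Import all_classical all_reals all_analysis.

Set Implicit Arguments.
Unset Strict Implicit.
Unset Printing Implicit Defensive.

Import Order.TTheory GRing.Theory Num.Theory.
Import numFieldNormedType.Exports.

Local Open Scope classical_set_scope.
Local Open Scope ring_scope.

(* Partial maps D -> Y are total functions together with their domain D; the
   definitions below never use values outside D. *)

(* The sets V `&` D are the neighbourhoods of z in the subspace D. *)
Definition open_at (S T : topologicalType) (D : set S) (f : S -> T) (z : S) :
    Prop :=
  forall V : set S, nbhs z V -> interior (f @` (V `&` D)) (f z).

Definition isolated_equilibrium (R : realType) (n m : nat)
    (X : set 'rV[R]_n) (U : set 'rV[R]_m)
    (f : 'rV[R]_n * 'rV[R]_m -> 'rV[R]_n) : Prop :=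
  \forall z \near ((0, 0) : 'rV[R]_n * 'rV[R]_m),
    (X `*` U) z -> (f z = 0 <-> z = (0, 0)).

Definition composition_operator (A B C : Type) (h : A -> B) (f : B -> C) :
    A -> C :=
  f \o h.

(* x solves x' = F(x), x(0) = x0, on [0, +oo[ inside O; only the values x t
   with 0 <= t matter, so the derivative at 0 is one-sided. *)
Definition is_solution (R : realType) (n : nat) (O : set 'rV[R]_n)
    (F : 'rV[R]_n -> 'rV[R]_n) (x0 : 'rV[R]_n) (x : R -> 'rV[R]_n) : Prop :=
  [/\ x 0 = x0,
      forall t : R, 0 <= t -> O (x t),
      s^-1 *: (x s - x 0) @[s --> (0 : R)^'+] --> F (x 0) &
      forall t : R, 0 < t -> is_derive t 1 x (F (x t))].

Definition uniquely_solvable (R : realType) (n : nat) (O : set 'rV[R]_n)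
    (F : 'rV[R]_n -> 'rV[R]_n) : Prop :=
  \forall x0 \near (0 : 'rV[R]_n),
    exists2 x : R -> 'rV[R]_n, is_solution O F x0 x &
      forall y : R -> 'rV[R]_n, is_solution O F x0 y ->
        forall t : R, 0 <= t -> y t = x t.

Definition lyapunov_stable (R : realType) (n : nat) (O : set 'rV[R]_n)
    (F : 'rV[R]_n -> 'rV[R]_n) : Prop :=
  forall e : R, 0 < e -> \forall x0 \near (0 : 'rV[R]_n),
    forall x : R -> 'rV[R]_n, is_solution O F x0 x ->
      forall t : R, 0 <= t -> `|x t| < e.

Definition locally_attractive (R : realType) (n : nat) (O : set 'rV[R]_n)
    (F : 'rV[R]_n -> 'rV[R]_n) : Prop :=
  \forall x0 \near (0 : 'rV[R]_n),
    forall x : R -> 'rV[R]_n, is_solution O F x0 x ->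
      x t @[t --> +oo] --> (0 : 'rV[R]_n).

Definition locally_asymptotically_stable (R : realType) (n : nat)
    (O : set 'rV[R]_n) (F : 'rV[R]_n -> 'rV[R]_n) : Prop :=
  [/\ F 0 = 0, lyapunov_stable O F & locally_attractive O F].

Definition stabilizes (R : realType) (n m : nat)
    (X : set 'rV[R]_n) (U : set 'rV[R]_m)
    (f : 'rV[R]_n * 'rV[R]_m -> 'rV[R]_n)
    (O : set 'rV[R]_n) (h : 'rV[R]_n -> 'rV[R]_n * 'rV[R]_m) : Prop :=
  [/\ nbhs (0 : 'rV[R]_n) O,
      O `<=` X,
      (forall x : 'rV[R]_n, O x -> (X `*` U) (h x)),
      {within O, continuous (composition_operator h f)} &
      uniquely_solvable O (composition_operator h f) /\
      locally_asymptotically_stable O (composition_operator h f)].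

Definition stationary (R : realType) (n m : nat)
    (h : 'rV[R]_n -> 'rV[R]_n * 'rV[R]_m) : Prop :=
  h 0 = (0, 0).

(* Main.v *)
Require Import Defs.
From mathcomp Require Import all_boot all_order all_algebra.
From mathcomp Require Import all_classical all_reals all_analysis.
From mathcomp Require Import ring lra.

Set Implicit Arguments.
Unset Strict Implicit.
Unset Printing Implicit Defensive.

Import Order.TTheory GRing.Theory Num.Theory.
Import numFieldNormedType.Exports.

Local Open Scope classical_set_scope.
Local Open Scope ring_scope.

(**
Sufficiency of openness is a matter of choosing preimages.  Near the origin
every - x has a preimage under f; let h x be one whose norm is minimal up to
an error of |x|.  Then f (h x) = - x, so the closed loop is the contraction
x' = - x on a ball, and openness at (0, 0) says exactly that small x have
preimages close to (0, 0), which makes h continuous at 0.  The norm-minimal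
choice is [near_minimal_section], the closed loop is treated by
[decay_asymptotically_stable].

For necessity, put F = f o h.  As h is continuous at 0, h maps a small
neighbourhood of 0 into any given neighbourhood of (0, 0), so it is enough that
the continuous field F is open at 0 ([asymptotically_stable_open]).  This is
the theorem of Brockett and of Krasnosel'skii and Zabreiko: on a small sphere
|p| = r the field F is homotopic, through nonvanishing fields, to p |-> - p.
The homotopy is t |-> (phi_t p - p) / t, which starts at F p for t = 0, cannot
vanish because a closed orbit is not attracted to 0, and at a large time T,
when the flow has contracted the sphere into the ball of radius r / 2, points
inwards.

Instead of a degree the argument glues the field and the homotopy into one
continuous map on the ball of radius 2 r ([radial_velocity]): it is F on the
inner ball, while on the outer shell the distance to the origin plays the role
of the time t.  A small perturbation of this map still points inwards on
the outer sphere, hence has a zero ([poincare_bohl]); the zero cannot lie in the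
shell, where the map is bounded away from 0, so it solves F x = y in the inner
ball.

Two ingredients carry the weight of the argument.  The zero comes from Brouwer's fixed
point theorem, which is derived from a combinatorial lemma on grids
([grid_cell_all_change]): this is Stokes' theorem for simplicial cochains modulo
2.  The continuity of the flow phi of a field which is merely continuous
([flow_continuous]) comes from uniqueness of solutions: being a solution that
stays in a fixed ball is, thanks to a uniform first order Taylor estimate
([trapped_taylor], [taylor_solution]), closed under pointwise limits.
*)

(** * Differences on a grid modulo two *)

Section GridForms.
Variable n : nat.
Implicit Types (x v : 'I_n -> nat) (i j l : 'I_n) (J : {set 'I_n}).
Implicit Types (f g : ('I_n -> nat) -> 'F_2) (fs : seq (('I_n -> nat) -> 'F_2)).

Definition set_coord x i c : 'I_n -> nat := fun j => if j == i then c else x j.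

Definition succ_coord i x : 'I_n -> nat := set_coord x i (x i).+1.

Definition grid_diff i f : ('I_n -> nat) -> 'F_2 := fun x => f (succ_coord i x) - f x.

(** The J-component of the cup product of the coboundaries of the functions in fs,
a discrete analogue of df_1 /\ .. /\ df_p.  The shift of the remaining factors by
one step in direction j is that of the cup product of simplicial cochains; it
is what makes the Leibniz rule [grid_diffM] exact.  Working modulo 2
removes the signs. *)
Fixpoint cup_diff fs J : ('I_n -> nat) -> 'F_2 :=
  if fs is f :: fs' then
    fun x => \sum_(j in J) grid_diff j f x * cup_diff fs' (J :\ j) (succ_coord j x)
  else fun=> 1.

Lemma succ_coordC i j x : succ_coord i (succ_coord j x) = succ_coord j (succ_coord i x).
Proof.
case: (eqVneq i j) => [->//|ij].
apply/funext => l; rewrite /succ_coord /set_coord (negPf ij) [j == i]eq_sym (negPf ij).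
by case: (eqVneq l i) => [->|//]; rewrite (negPf ij).
Qed.

Lemma grid_diffC i j f : grid_diff i (grid_diff j f) = grid_diff j (grid_diff i f).
Proof.
by apply/funext => x; rewrite /grid_diff succ_coordC; ring.
Qed.

Lemma grid_diffM j f g x :
  grid_diff j (fun y => f y * g y) x = grid_diff j f x * g (succ_coord j x) + f x * grid_diff j g x.
Proof. by rewrite /grid_diff; ring. Qed.

Lemma grid_diff_sum j J (F : 'I_n -> ('I_n -> nat) -> 'F_2) x :
  grid_diff j (fun y => \sum_(l in J) F l y) x = \sum_(l in J) grid_diff j (F l) x.
Proof. by rewrite /grid_diff -sumrB. Qed.

(** The pairs i < j and j < i contribute equally, and 2 = 0.  This replaces the
sign argument behind d o d = 0. *)
Lemma double_sum_sym_F2 J (a : 'I_n -> 'I_n -> 'F_2) :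
  (forall i j, a i j = a j i) -> \sum_(i in J) \sum_(j in J :\ i) a i j = 0.
Proof.
move=> aC.
have -> : \sum_(i in J) \sum_(j in J :\ i) a i j =
  \sum_(i in J) (\sum_(j in J | (i < j)%N) a i j + \sum_(j in J | (j < i)%N) a i j).
  apply: eq_bigr => i _; rewrite (bigID (fun j => (i < j)%N)) /=; congr (_ + _);
    apply: eq_bigl => j; rewrite !inE.
  - by case: (ltngtP i j) => //= ij; rewrite ?andbF ?andbT // -(inj_eq val_inj) /= gtn_eqF.
  - by rewrite -(inj_eq val_inj) /= andbAC andbC; case: (ltngtP i j).
rewrite big_split /= (exchange_big_dep (mem J)) /=; last by move=> ? ? _ /andP[].
rewrite -big_split /= big1 // => i Ji.
rewrite -[RHS](_ : (\sum_(j in J | (j < i)%N) a i j) *+ 2 = 0); last first.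
  by rewrite -mulr_natr (_ : 2%:R = 0) ?mulr0 //; apply/val_inj.
rewrite mulr2n; congr (_ + _).
by apply: eq_big => [j|j _]; [rewrite Ji | rewrite aC].
Qed.

(** By the Leibniz rule and induction, a cup product of coboundaries is itself the
coboundary of [f] times the remaining factors, and coboundaries are closed
because differences in two directions commute. *)
Lemma cup_diff_closed fs J x :
  \sum_(j in J) grid_diff j (cup_diff fs (J :\ j)) x = 0.
Proof.
elim: fs J x => [|f fs IH] J x /=.
  by apply: big1 => j _; rewrite /grid_diff subrr.
have cupE K y : cup_diff (f :: fs) K y =
    \sum_(j in K) grid_diff j (fun z => f z * cup_diff fs (K :\ j) z) y.
  under [RHS]eq_bigr do rewrite grid_diffM.
  by rewrite big_split /= -mulr_sumr IH mulr0 addr0.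
under eq_bigr => j _.
  rewrite (_ : (fun y => _) = fun y => \sum_(l in J :\ j)
     grid_diff l (fun z => f z * cup_diff fs (J :\ j :\ l) z) y); last first.
    by apply/funext => y; rewrite -cupE.
  rewrite grid_diff_sum; over.
apply: (@double_sum_sym_F2 J (fun i j =>
  grid_diff i (grid_diff j (fun z => f z * cup_diff fs (J :\ i :\ j) z)) x)) => i j.
by rewrite grid_diffC !finset.setDDl finset.setUC.
Qed.

(** This is d (f w) = df w + f dw with dw = 0; it turns sums of [cup_diff] over a box
into sums over its faces. *)
Lemma cup_diff_exact f fs J x : cup_diff (f :: fs) J x =
  \sum_(j in J) grid_diff j (fun z => f z * cup_diff fs (J :\ j) z) x.
Proof.
under [RHS]eq_bigr do rewrite grid_diffM.
by rewrite big_split /= -mulr_sumr cup_diff_closed mulr0 addr0.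
Qed.

Variable k : nat.

(** Only the coordinates in js are summed over; the other ones are read off from
the argument, which allows faces of the grid to be treated by the same
definition. *)
Fixpoint box_sum js g : ('I_n -> nat) -> 'F_2 :=
  if js is j :: js' then fun x => \sum_(c < k) box_sum js' g (set_coord x j c) else g.

Lemma set_coordC x i j a b : i != j ->
  set_coord (set_coord x i a) j b = set_coord (set_coord x j b) i a.
Proof.
move=> ij; apply/funext => l; rewrite /set_coord.
by case: (eqVneq l j) => // ->; rewrite eq_sym (negPf ij).
Qed.

Lemma box_sum_sum js J (F : 'I_n -> ('I_n -> nat) -> 'F_2) x :
  box_sum js (fun y => \sum_(l in J) F l y) x = \sum_(l in J) box_sum js (F l) x.
Proof.
elim: js x => [//|j js IH] x /=.
by rewrite exchange_big /=; apply: eq_bigr => c _; rewrite IH.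
Qed.

Lemma eq_box_sum js g g' x : (forall y, (forall j, j \notin js -> y j = x j) -> g y = g' y) ->
  box_sum js g x = box_sum js g' x.
Proof.
elim: js x => [|j js IH] x gg' /=; first exact: gg'.
apply: eq_bigr => c _; apply: IH => y yE; apply: gg' => l.
rewrite inE negb_or => /andP[lj ljs]; rewrite yE // /set_coord (negPf lj); exact.
Qed.

(** Discrete Stokes: in direction j the sum telescopes and leaves the two faces
x j = k and x j = 0. *)
Lemma box_sum_diff js j g x : j \in js -> uniq js ->
  box_sum js (grid_diff j g) x =
  box_sum (rem j js) (fun y => g (set_coord y j k) - g (set_coord y j 0%N)) x.
Proof.
elim: js x => [//|l js IH] x; rewrite inE /= => jl /andP[ljs ujs].
case: (eqVneq l j) => [lj|lj] /=.
  rewrite {l jl}lj in ljs *.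
  have Eupd g' c y : box_sum js g' (set_coord y j c) = box_sum js (fun z => g' (set_coord z j c)) y.
    elim: js {IH ujs} ljs y => [//|l js IH]; rewrite inE negb_or => /andP[jl jjs] y /=.
    by apply: eq_bigr => d _; rewrite set_coordC // IH.
  under eq_bigr do rewrite Eupd.
  elim: js {IH ujs ljs Eupd} x => [|l js IH] x /=; last first.
    by rewrite exchange_big; apply: eq_bigr => c _; rewrite IH.
  rewrite -(big_mkord xpredT (fun c => grid_diff j g (set_coord x j c))).
  rewrite -(telescope_sumr (fun c => g (set_coord x j c))) //; apply: eq_bigr => c _.
  rewrite /grid_diff; congr (g _ - _); apply/funext => i.
  by rewrite /succ_coord /set_coord eqxx; case: eqP.
rewrite eq_sym (negPf lj) /= in jl.
by apply: eq_bigr => c _; rewrite IH.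
Qed.

(** If j is not in J, all steps taken by [cup_diff] stay on the slice through x
orthogonal to direction j, on which the difference of f vanishes. *)
Lemma cup_diff_const fs J j x : j \notin J ->
  (exists2 f, f \in fs & exists c, forall y, y j = x j -> f y = c) ->
  cup_diff fs J x = 0.
Proof.
elim: fs J x => [|f fs IH] J x jJ [g]; first by rewrite inE.
rewrite inE => /orP[/eqP-> [c gc] /=|gfs gc /=]; apply: big1 => l lJ.
  have jl : j != l by apply: contraNneq jJ => ->.
  by rewrite /grid_diff !gc ?subrr ?mul0r // /succ_coord /set_coord (negPf jl).
have jl : j != l by apply: contraNneq jJ => ->.
rewrite IH ?mulr0 ?inE ?(negPf jJ) ?andbF //.
by exists g => //; rewrite {1}/succ_coord /set_coord (negPf jl).
Qed.

Variable F : 'I_n -> ('I_n -> nat) -> 'F_2.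
Hypothesis F0 : forall i x, x i = 0%N -> F i x = 0.
Hypothesis Fk : forall i x, x i = k -> F i x = 1.

(** By exactness and Stokes the sum reduces to faces.  On a face orthogonal to a
direction j other than i the factor F j is constant, so the face contributes
nothing; on the face x i = 0 the factor F i vanishes; on the face x i = k it is
1, and what is left is the same sum with one function less. *)
Lemma box_sum_cup_diff js : uniq js ->
  box_sum js (cup_diff (map F js) [set j in js]) (fun=> k) = 1.
Proof.
elim: js => [//|i js IH] /= /andP[ijs ujs].
rewrite -[LHS]/(box_sum (i :: js) (cup_diff (F i :: map F js) [set j in i :: js]) (fun=> k)).
transitivity (box_sum (i :: js) (fun y => \sum_(j in [set j in i :: js])
   grid_diff j (fun z => F i z * cup_diff (map F js) ([set j in i :: js] :\ j) z) y) (fun=> k)).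
  by apply: eq_box_sum => y _; rewrite cup_diff_exact.
have iJ : i \in [set j in i :: js] by rewrite !inE eqxx.
rewrite box_sum_sum (bigD1 i) //= [X in _ + X]big1 ?addr0; last first.
  move=> j; rewrite !inE => /andP[/orP[->//|jjs] ji].
  rewrite -[LHS]/(box_sum (i :: js) (grid_diff j _) _).
  rewrite box_sum_diff ?inE ?jjs ?orbT //=; last by rewrite ijs.
  rewrite (eq_box_sum (g' := fun=> 0)); last first.
    have z0 c y : c = 0%N \/ c = k ->
        cup_diff (map F js) ([set j in i :: js] :\ j) (set_coord y j c) = 0.
      move=> c0k; apply: (@cup_diff_const _ _ j); first by rewrite !inE eqxx.
      exists (F j); first exact: map_f.
      case: c0k => ->; [exists 0 => z zj; apply: F0|exists 1 => z zj; apply: Fk];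
        by rewrite zj /set_coord eqxx.
    by move=> y _; rewrite !z0 ?mulr0 ?subrr //; [left|right].
  elim: (if _ then _ else _) (fun=> k) => [//|l s IHs] x /=.
  by apply: big1 => c _; apply: IHs.
rewrite -[LHS]/(box_sum (i :: js) (grid_diff i _) _) box_sum_diff ?mem_head //=;
  last by rewrite ijs.
rewrite eqxx -[RHS]IH //; apply: eq_box_sum => y yE.
rewrite Fk ?F0 /set_coord ?eqxx // mul0r mul1r subr0.
rewrite (_ : [set j in i :: js] :\ i = [set j in js]); last first.
  by apply/setP => l; rewrite !inE; case: eqVneq => // ->; rewrite (negPf ijs).
by congr (cup_diff _ _ _); apply/funext => l; case: eqVneq => // ->; rewrite yE.
Qed.

Lemma box_sum_neq0 js g x : box_sum js g x != 0 ->
  exists2 y, (forall j, j \in js -> (y j < k)%N) & g y != 0.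
Proof.
(* The coordinates outside js are fixed, which the induction needs. *)
move=> H; suff [y [y1 _ y3]] : exists y,
    [/\ forall j, j \in js -> (y j < k)%N, forall j, j \notin js -> y j = x j & g y != 0].
  by exists y.
elim: js x H => [|j js IH] x /=; first by exists x.
move=> H.
have /existsP[c /IH [y [y1 y2 y3]]] : [exists c : 'I_k, box_sum js g (set_coord x j c) != 0].
  by apply: contraNT H => /existsPn H; apply/eqP/big1 => c _; apply/eqP; move: (H c); rewrite negbK.
exists y; split => //.
  move=> l; rewrite inE; case: (boolP (l \in js)) => [/y1//|ljs].
  by rewrite orbF => /eqP lj; rewrite y2 // lj /set_coord eqxx.
move=> l; rewrite inE negb_or => /andP[lj ljs].
by rewrite y2 // /set_coord (negPf lj).
Qed.

(** Each factor of a nonzero term is a difference of f along an edge of the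
unit cell based at x. *)
Lemma cup_diff_neq0 fs J x : cup_diff fs J x != 0 -> forall f, f \in fs ->
  exists v v', [/\ f v != f v',
    forall j, (x j <= v j <= x j + (j \in J))%N & forall j, (x j <= v' j <= x j + (j \in J))%N].
Proof.
elim: fs J x => [//|g fs IH] J x /= H f.
have /existsP[l /andP[lJ /[!mulf_eq0] /[!negb_or] /andP[dg cfs]]] :
    [exists l, (l \in J) && (grid_diff l g x * cup_diff fs (J :\ l) (succ_coord l x) != 0)].
  apply: contraNT H => /existsPn H; apply/eqP/big1 => c cJ; apply/eqP.
  by move: (H c); rewrite cJ /= negbK.
rewrite inE => /orP[/eqP->|ffs].
  exists (succ_coord l x), x; split.
  - by rewrite -subr_eq0.
  - move=> j; rewrite /succ_coord /set_coord.
    by case: eqVneq => [->|_]; rewrite ?lJ ?addn1 ?leqnn ?leqnSn ?leq_addr.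
  - by move=> j; rewrite leqnn leq_addr.
have [v [v' [fvv' Hv Hv']]] := IH _ _ cfs _ ffs; exists v, v'; split => // j.
- have /andP[] := Hv j; rewrite /succ_coord /set_coord !inE.
  case: eqVneq => [->|_] /=; rewrite ?lJ ?addn0 ?addn1 => a b; last by rewrite a.
  by rewrite b andbT ltnW.
- have /andP[] := Hv' j; rewrite /succ_coord /set_coord !inE.
  case: eqVneq => [->|_] /=; rewrite ?lJ ?addn0 ?addn1 => a b; last by rewrite a.
  by rewrite b andbT ltnW.
Qed.

(** A combinatorial form of the Poincare-Miranda theorem.  The sum of [cup_diff] over
the whole box is 1, so some cell has a nonzero summand. *)
Theorem grid_cell_all_change : exists x : 'I_n -> nat,
  (forall j, (x j < k)%N) /\
  forall i, exists v v', [/\ F i v != F i v',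
    forall j, (x j <= v j <= (x j).+1)%N & forall j, (x j <= v' j <= (x j).+1)%N].
Proof.
have : box_sum (enum 'I_n) (cup_diff (map F (enum 'I_n)) [set j in enum 'I_n]) (fun=> k) != 0.
  by rewrite box_sum_cup_diff ?enum_uniq ?oner_eq0.
move=> /box_sum_neq0[x xk /cup_diff_neq0 H]; exists x; split.
  by move=> j; apply: xk; rewrite mem_enum.
move=> i; have [|v [v' [? Hv Hv']]] := H (F i); first by rewrite map_f ?mem_enum.
exists v, v'; split => // j; [move: (Hv j)|move: (Hv' j)];
  by rewrite inE mem_enum inE addn1.
Qed.

End GridForms.

(** * Brouwer's fixed point theorem *)

(** The form in which a property valid near x enters covering arguments: it holds on
balls of a common radius around all nearby centres. *)
Lemma near_ball_near (R : realType) (n : nat) (Q : 'rV[R]_n -> Prop) (x : 'rV[R]_n) :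
  (\forall v \near x, Q v) ->
  \forall x' \near x & e \near (0 : R)^'+, forall v, `|v - x'| <= e -> Q v.
Proof.
move=> /nbhs_ballP[d /= d0 dQ].
exists (ball x (d / 2), [set e | e < d / 2]) => /=.
  split; first by apply: nbhsx_ballx; rewrite divr_gt0.
  by apply: nbhs_right_lt; rewrite divr_gt0.
move=> [x' e] /= [xx' ed] v vx'; apply: dQ.
move: xx'; rewrite -!ball_normE /= => xx'.
rewrite -(subrKA x') (le_lt_trans (ler_normD _ _)) // [ltRHS]splitr ltrD //.
by rewrite distrC (le_lt_trans vx').
Qed.

(** A Lebesgue number: the radii that are available locally can be chosen
uniformly over a compact set. *)
Lemma compact_uniform_radius (R : realType) (n : nat) (K : set 'rV[R]_n)
    (P : R -> 'rV[R]_n -> Prop) : compact K ->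
  (forall x, K x -> \forall x' \near x & e \near (0 : R)^'+, P e x') ->
  exists2 e, 0 < e & forall x, K x -> P e x.
Proof.
move=> Kc KP.
have H : \forall e \near (0 : R)^'+, K `<=` P e.
  exact: ((compact_near_coveringP _).1 Kc).
have /filter_ex[e [e0 He]] : \forall e \near (0 : R)^'+, 0 < e /\ K `<=` P e.
  by near=> e; split; near: e => //; exact: nbhs_right_gt.
by exists e.
Unshelve. all: by end_near. Qed.

Section RowVectors.
Variables (R : realType) (n : nat).
Implicit Types x v : 'rV[R]_n.

Lemma coord_le_norm v i : `|v 0 i| <= `|v|.
Proof.
by rewrite [leRHS]/Num.Def.normr/= mx_normrE; exact: (le_bigmax _ _ (0, i)).
Qed.

Lemma norm_le_coord v e : 0 <= e -> (forall i, `|v 0 i| <= e) -> `|v| <= e.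
Proof.
move=> e0 ve; rewrite [leLHS]/Num.Def.normr/= mx_normrE (bigmax_le _ e0)//=.
by move=> -[i j] _; rewrite /= ord1.
Qed.

Lemma compact_norm_le (rho : R) : compact [set x : 'rV[R]_n | `|x| <= rho].
Proof.
apply: bounded_closed_compact.
  by exists rho; split; [exact: num_real|move=> M rM x /= xr; exact: le_trans xr (ltW rM)].
by apply: (@closed_comp _ _ (@Num.norm R 'rV[R]_n) [set y | y <= rho]);
  [move=> y _; exact: norm_continuous|exact: closed_le].
Qed.

(** The functions fed to the grid lemma record the sign of x i - G x i.  Since G
maps into the ball of radius rho, which is a cube for the maximum norm, the
boundary values required there agree with these signs up to equality. *)
Lemma sign_change_cell (rho : R) (G : 'rV[R]_n -> 'rV[R]_n) (e : R) :
  0 < rho -> 0 < e -> (forall x, `|G x| <= rho) ->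
  exists2 x, `|x| <= rho & forall i, exists v v',
    [/\ `|v - x| <= e, `|v' - x| <= e, G v 0 i <= v 0 i & v' 0 i <= G v' 0 i].
Proof.
move=> rho0 e0 Grho.
have [k k0 ke] : exists2 k, (0 < k)%N & 2 * rho / k%:R <= e.
  exists (Num.bound (2 * rho / e)).+1 => //.
  have : 2 * rho / e < (Num.bound (2 * rho / e))%:R.
    by apply: archi_boundP; rewrite divr_ge0 ?mulr_ge0 // ltW.
  rewrite ltr_pdivrMr // => H; rewrite ler_pdivrMr ?ltr0Sn //.
  by rewrite [e * _]mulrC (le_trans (ltW H)) // ler_pM2r // ler_nat.
have kR0 : 0 < k%:R :> R by rewrite ltr0n.
pose P (v : 'I_n -> nat) : 'rV[R]_n := \row_i (2 * rho / k%:R * (v i)%:R - rho).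
pose F i (v : 'I_n -> nat) : 'F_2 :=
  ((v i != 0%N) && ((v i == k) || (G (P v) 0 i <= P v 0 i)))%:R.
have Gle v i : - rho <= G v 0 i <= rho.
  by rewrite -ler_norml (le_trans (coord_le_norm _ _)).
have F1 i (v : 'I_n -> nat) : F i v != 0 -> G (P v) 0 i <= P v 0 i.
  rewrite /F; case: (boolP (_ && _)) => [|_]; last by rewrite eqxx.
  move=> /andP[_ /orP[/eqP vk _|//]].
  by rewrite mxE vk divfK ?gt_eqF //; have /andP[_] := Gle (P v) i; lra.
have F0 i (v : 'I_n -> nat) : F i v = 0 -> P v 0 i <= G (P v) 0 i.
  rewrite /F; case: (boolP (_ && _)) => [_ /eqP|]; first by rewrite oner_eq0.
  rewrite negb_and negbK negb_or => /orP[/eqP v0 _|/andP[_]].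
    by rewrite mxE v0 mulr0 add0r; have /andP[] := Gle (P v) i.
  by rewrite -ltNge => /ltW.
have [||x [xk xF]] := @grid_cell_all_change n k F.
- by move=> i x xi; rewrite /F xi eqxx.
- by move=> i x xi; rewrite /F xi eqxx /= -lt0n k0.
have Px (y : 'I_n -> nat) : (forall j, (x j <= y j <= (x j).+1)%N) -> `|P y - P x| <= e.
  move=> xy; apply: norm_le_coord; first exact: ltW.
  move=> i; rewrite !mxE opprB addrA subrK -mulrBr.
  have /andP[xy1 xy2] := xy i.
  have c0 : 0 < 2 * rho / k%:R by rewrite divr_gt0 ?mulr_gt0.
  rewrite normrM gtr0_norm // -natrB // normr_nat (le_trans _ ke) //.
  by rewrite ler_piMr ?(ltW c0) // (ler_nat _ _ 1%N) leq_subLR addn1.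
exists (P x).
  apply: norm_le_coord; first exact: ltW.
  move=> i; rewrite mxE ler_norml.
  have c0 : 0 < 2 * rho / k%:R by rewrite divr_gt0 ?mulr_gt0.
  have : 0 <= 2 * rho / k%:R * (x i)%:R <= 2 * rho / k%:R * k%:R.
    by rewrite mulr_ge0 ?(ltW c0) //= ler_pM2l // ler_nat ltnW.
  by rewrite divfK ?gt_eqF // => /andP[? ?]; apply/andP; split; lra.
move=> i; have [v [v' [vv' Hv Hv']]] := xF i.
case: (eqVneq (F i v) 0) vv' => [v0|v0].
  rewrite v0 eq_sym => v'0; exists (P v'), (P v).
  by split; [exact: Px|exact: Px|exact: F1|exact: F0].
have v1 : F i v = 1 by move: v0; rewrite /F; case: (_ && _).
rewrite v1 => v'0; exists (P v), (P v'); split; [exact: Px|exact: Px|exact: F1|].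
by apply: F0; move: v'0; rewrite /F; case: (_ && _).
Qed.

(** Without a fixed point, every x has a coordinate in which G v - v keeps a
strict sign for all v near x, at a scale that is uniform by compactness;
a cell of that size contradicts this. *)
Theorem brouwer (rho : R) (G : 'rV[R]_n -> 'rV[R]_n) :
  0 < rho -> continuous G -> (forall x, `|G x| <= rho) -> exists x, G x = x.
Proof.
move=> rho0 Gc Grho; apply: contrapT => nofix.
have dc i : continuous (fun v : 'rV[R]_n => G v 0 i - v 0 i).
  move=> v; apply: (@continuousB _ _ _ (fun v => G v 0 i) (fun v : 'rV[R]_n => v 0 i));
    last exact: coord_continuous.
  exact: (continuous_comp (Gc v) (@coord_continuous _ _ _ 0 i (G v))).
pose one_signed (e : R) x := exists i,
  (forall v, `|v - x| <= e -> G v 0 i - v 0 i < 0) \/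
  (forall v, `|v - x| <= e -> 0 < G v 0 i - v 0 i).
have [|e e0 He] := compact_uniform_radius (P := one_signed) (@compact_norm_le rho).
  move=> x _.
  have [i Gi] : exists i, G x 0 i != x 0 i.
    apply: contrapT => /forallNP H; apply: nofix; exists x; apply/rowP => i.
    by have /negP := H i; rewrite negbK => /eqP.
  case: (ltgtP (G x 0 i) (x 0 i)) Gi => // Gi _.
  - have : \forall v \near x, G v 0 i - v 0 i < 0.
      by apply: (cvgr_lt _ (dc i x)); rewrite subr_lt0.
    by move=> /near_ball_near; apply: filterS => -[x' e] /= H; exists i; left.
  - have : \forall v \near x, 0 < G v 0 i - v 0 i.
      by apply: (cvgr_gt _ (dc i x)); rewrite subr_gt0.
    by move=> /near_ball_near; apply: filterS => -[x' e] /= H; exists i; right.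
have [x /He[i Hi] cell] := sign_change_cell rho0 e0 Grho.
have [v [v' [ve v'e Gv Gv']]] := cell i.
case: Hi => Hi; first by have := Hi _ v'e; rewrite subr_lt0 ltNge Gv'.
by have := Hi _ ve; rewrite subr_gt0 ltNge Gv.
Qed.

End RowVectors.

(** * Zeros of fields which point inwards *)

Section Clamp.
Variables (R : realType) (n : nat).
Implicit Types (x : 'rV[R]_n) (rho : R).

(** The radial retraction onto the closed ball of radius rho. *)
Definition clamp rho x := (rho / Num.max rho `|x|) *: x.

Lemma continuous_clamp rho : 0 < rho -> continuous (clamp rho).
Proof.
move=> rho0 x; apply: (@continuousZ _ _ _ (fun x => rho / Num.max rho `|x|) id); last exact: cvg_id.
apply: (@continuousM _ _ (fun=> rho) (fun x => (Num.max rho `|x|)^-1)); first exact: cst_continuous.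
apply: (@continuousV _ _ (fun x => Num.max rho `|x|)).
  by rewrite gt_eqF // lt_max rho0.
apply: (@continuous_max _ _ (fun=> rho) (fun x => `|x|)); first exact: cst_continuous.
exact: norm_continuous.
Qed.

Lemma clamp_id rho x : 0 < rho -> `|x| <= rho -> clamp rho x = x.
Proof. by move=> rho0 xr; rewrite /clamp max_l // divff ?gt_eqF // scale1r. Qed.

Lemma norm_clamp_ge rho x : 0 < rho -> rho <= `|x| -> `|clamp rho x| = rho.
Proof.
move=> rho0 xr; have x0 : 0 < `|x| by exact: lt_le_trans xr.
by rewrite /clamp max_r // normrZ ger0_norm ?divr_ge0 ?ltW // divfK ?gt_eqF.
Qed.

Lemma norm_clamp_le rho x : 0 < rho -> `|clamp rho x| <= rho.
Proof.
move=> rho0; case: (leP `|x| rho) => [xr|/ltW xr]; first by rewrite clamp_id.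
by rewrite norm_clamp_ge.
Qed.

(** If V had no zero, rescaling V o clamp to norm rho would give a continuous map
into the sphere, and at its fixed point V is a nonnegative multiple of x. *)
Theorem poincare_bohl rho (V : 'rV[R]_n -> 'rV[R]_n) :
  0 < rho -> continuous V ->
  (forall x l, `|x| = rho -> 0 <= l -> V x <> l *: x) ->
  exists2 x, `|x| <= rho & V x = 0.
Proof.
move=> rho0 Vc Vout; apply: contrapT => noV.
have V0 x : 0 < `|V (clamp rho x)|.
  rewrite normr_gt0; apply/eqP => Vx; apply: noV.
  by exists (clamp rho x) => //; exact: norm_clamp_le.
(* Composing with the retraction makes the rescaled field globally defined. *)
pose G x := (rho / `|V (clamp rho x)|) *: V (clamp rho x).
have normG x : `|G x| = rho.
  by rewrite normrZ ger0_norm ?divr_ge0 ?ltW // divfK // gt_eqF.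
have Gc : continuous G.
  have Vcc : continuous (fun x => V (clamp rho x)).
    by move=> x; apply: continuous_comp; [exact: continuous_clamp|exact: Vc].
  move=> x; apply: (@continuousZ _ _ _ (fun x => rho / `|V (clamp rho x)|) (fun x => V (clamp rho x)));
    last exact: Vcc.
  apply: (@continuousM _ _ (fun=> rho) (fun x => `|V (clamp rho x)|^-1));
    first exact: cst_continuous.
  apply: (@continuousV _ _ (fun x => `|V (clamp rho x)|)); first by rewrite gt_eqF.
  exact: (continuous_comp (Vcc x) (@norm_continuous _ _ _)).
have [x Gx] : exists x, G x = x by apply: (brouwer rho0 Gc) => x; rewrite normG.
have xr : `|x| = rho by rewrite -Gx normG.
have cx : clamp rho x = x by rewrite clamp_id ?xr.
apply: (Vout x (`|V x| / rho)) => //; first by rewrite divr_ge0 ?(ltW rho0).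
have Vx : 0 < `|V x| by rewrite -cx.
rewrite (_ : _ *: x = (`|V x| / rho) *: G x); last by rewrite Gx.
by rewrite /G cx scalerA mulrA divfK ?gt_eqF // divff ?gt_eqF // scale1r.
Qed.

End Clamp.

(** * Solutions of autonomous equations *)

(** Restates the derivative with the increment h in place of h *: 1, so that it
can be compared with the one-sided quotient that defines a solution at time 0. *)
Lemma is_derive_quotientP (R : realType) (V : normedModType R) (x : R -> V) (t : R) v :
  is_derive t 1 x v <-> h^-1 *: (x (h + t) - x t) @[h --> 0^'] --> v.
Proof.
have E : (fun h : R => h^-1 *: (x (h *: 1 + t) - x t)) =
         (fun h : R => h^-1 *: (x (h + t) - x t)).
  by apply/funext => h; rewrite [h *: 1]mulr1.
split=> [[dx Dx]|H].
  by rewrite -Dx /derive E; move: dx; rewrite /derivable E.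
by apply: DeriveDef; [rewrite /derivable E; exact: cvgP H|rewrite /derive E; exact: cvg_lim H].
Qed.

Section Solutions.
Variables (R : realType) (n : nat) (O : set 'rV[R]_n) (F : 'rV[R]_n -> 'rV[R]_n).
Implicit Types x : R -> 'rV[R]_n.

Lemma solution_right_continuous0 p x : is_solution O F p x -> x t @[t --> 0^'+] --> x 0.
Proof.
move=> [_ _ d0 _].
have H : x 0 + s *: (s^-1 *: (x s - x 0)) @[s --> (0 : R)^'+] --> x 0 + 0 *: F (x 0).
  apply: cvgD; first exact: cvg_cst.
  apply: cvgZ => //.
  by apply: cvg_at_right_filter; exact: cvg_id.
rewrite scale0r addr0 in H; apply: cvg_trans H; apply: near_eq_cvg.
near=> s; rewrite scalerA divff ?scale1r; first by rewrite addrC subrK.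
by rewrite gt_eqF //; near: s; exact: nbhs_right_gt.
Unshelve. all: by end_near. Qed.

Lemma coord_is_derive x (t : R) v i :
  is_derive t 1 x v -> is_derive t 1 (fun s => x s 0 i) (v 0 i).
Proof.
move=> [dx Dx]; apply: DeriveDef; first exact: ((derivable_mxP _ _ _).1 dx).
by rewrite -Dx derive_mx // mxE.
Qed.

Lemma solution_coord_continuous p x i (a b : R) : is_solution O F p x -> 0 <= a -> a < b ->
  {within `[a, b], continuous (fun t => x t 0 i)}.
Proof.
move=> xsol a0 ab; have [_ _ d0 dx] := xsol.
have cont t : 0 < t -> {for t, continuous (fun t => x t 0 i)}.
  move=> t0; apply: differentiable_continuous; apply/derivable1_diffP.
  exact: (@ex_derive _ _ _ _ _ _ _ (coord_is_derive i (dx t t0))).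
apply/continuous_within_itvP => //; split.
- by move=> t; rewrite in_itv /= => /andP[a_t _]; apply: cont; exact: le_lt_trans a_t.
- move: a0; rewrite le_eqVlt => /orP[/eqP<-|a0].
    have := solution_right_continuous0 xsol.
    by move=> /(continuous_cvg _ (@coord_continuous _ _ _ 0 i (x 0))).
  by apply: cvg_at_right_filter; exact: cont.
- by apply: cvg_at_left_filter; apply: cont; exact: le_lt_trans ab.
Qed.

(** Only the coordinates obey a mean value theorem.  The endpoints come in either
order, since the Taylor estimate below must be two-sided in time. *)
Lemma solution_MVT p x i (a b : R) : is_solution O F p x -> 0 <= a -> 0 <= b ->
  exists c, [/\ 0 <= c, `|c - a| <= `|b - a| & x b 0 i - x a 0 i = F (x c) 0 i * (b - a)].
Proof.
move=> xsol.
have MVTlt s t : 0 <= s -> s < t ->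
    exists c, [/\ s < c, c < t & x t 0 i - x s 0 i = F (x c) 0 i * (t - s)].
  move=> s0 st.
  have [u|c cst E] := @MVT R (fun u => x u 0 i) (fun u => F (x u) 0 i) s t st _
     (@solution_coord_continuous p x i s t xsol s0 st).
    rewrite in_itv /= => /andP[su _]; apply: coord_is_derive.
    by have [_ _ _] := xsol; apply; exact: le_lt_trans su.
  by exists c; move: cst; rewrite in_itv /= => /andP[sc ct].
move=> a0 b0; case: (ltgtP a b) => [ab|ba|->].
- have [c [ac cb E]] := MVTlt _ _ a0 ab; exists c; split => //.
    by rewrite (le_trans a0) ?ltW.
  by rewrite !gtr0_norm ?subr_gt0 // lerD2r ltW.
- have [c [bc ca E]] := MVTlt _ _ b0 ba; exists c; split => //.
    by rewrite (le_trans b0) ?ltW.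
    by rewrite !ltr0_norm ?subr_lt0 // lerN2 lerD2r ltW.
  by rewrite -opprB E -mulrN opprB.
- by exists b; split => //; rewrite !subrr mulr0.
Qed.

Lemma is_derive_shift x (T t : R) v :
  is_derive (t + T) 1 x v -> is_derive t 1 (fun s => x (s + T)) v.
Proof.
have E : (fun h => h^-1 *: (x (h *: 1 + t + T) - x (t + T))) =
         (fun h => h^-1 *: (x (h *: 1 + (t + T)) - x (t + T))).
  by apply/funext => h; rewrite addrA.
by move=> [dx Dx]; apply: DeriveDef; rewrite /derivable /derive /= E.
Qed.

Lemma solution_shift p x T : is_solution O F p x -> 0 <= T ->
  is_solution O F (x T) (fun t => x (t + T)).
Proof.
move=> [xE xO d0 dx]; rewrite le_eqVlt => /orP[/eqP<-|T0].
  by under eq_fun do rewrite addr0; split.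
split; first by rewrite add0r.
- by move=> t t0; apply: xO; rewrite addr_ge0 // ltW.
- by have /is_derive_quotientP/cvg_dnbhs_at_right := dx _ T0; rewrite add0r.
- by move=> t t0; apply: is_derive_shift; apply: dx; rewrite addr_gt0.
Qed.

(** Hence attractivity excludes zeros of the field near the origin, except the
origin itself. *)
Lemma constant_solution p : O p -> F p = 0 -> is_solution O F p (fun=> p).
Proof.
move=> Op Fp; split => // [|t _]; rewrite Fp.
  by under eq_fun do rewrite subrr scaler0; exact: cvg_cst.
exact: is_derive_cst.
Qed.

End Solutions.

(** * Continuity of the flow of a continuous field *)

(** A cluster point of the image of an ultrafilter is a limit. *)
Lemma compact_ultra_fmap (T : Type) (U : topologicalType) (G : set_system T)
  (f : T -> U) (K : set U) : UltraFilter G -> compact K -> G (f @^-1` K) ->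
  exists2 l, K l & f @ G --> l.
Proof.
move=> GU Kc GK; have GPF : ProperFilter G by exact: ultra_proper.
have [|l [Kl lG]] := Kc (f @ G) _; first exact: GK.
exists l => // A lA; have [//|GnA] := in_ultra_setVsetC (f @^-1` A) GU.
by have [y [nAy Ay]] := lG (~` A) A GnA lA.
Qed.

Section BoundedSolutions.
Variables (R : realType) (n : nat) (O : set 'rV[R]_n) (F : 'rV[R]_n -> 'rV[R]_n).
Variable (rho : R).
Hypothesis rho_O : forall p : 'rV[R]_n, `|p| <= rho -> O p.
Hypothesis F_cont : forall p : 'rV[R]_n, `|p| <= rho -> {for p, continuous F}.

Definition trapped (x : R -> 'rV[R]_n) := forall t, 0 <= t -> `|x t| <= rho.

Definition trapped_solution (x : R -> 'rV[R]_n) := is_solution O F (x 0) x /\ trapped x.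

Lemma field_unif_continuous (e : R) : 0 < e -> exists2 d, 0 < d &
  forall p q, `|p| <= rho -> `|q - p| <= d -> `|F q - F p| <= e.
Proof.
move=> e0.
have [|d d0 dH] := compact_uniform_radius
    (P := fun d p => forall q, `|q - p| <= d -> `|F q - F p| <= e) (@compact_norm_le R n rho).
  move=> p /F_cont Fp.
  have /cvgr_dist_le/(_ (e / 2)) := Fp; rewrite divr_gt0 // => /(_ isT) /near_ball_near.
  have : \forall p' \near p & d \near (0 : R)^'+, 0 < d.
    exists (setT, [set d | 0 < d]) => [|[? ?] []//].
    by split; [exact: filterT|exact: nbhs_right_gt].
  apply: filterS2 => -[p' d] /= d0 H q qp'.
  rewrite -(subrKA (F p)) (le_trans (ler_normD _ _)) // [leRHS]splitr lerD //.
    by rewrite distrC; exact: H.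
  by apply: H; rewrite subrr normr0 ltW.
by exists d => // p q pr qp; exact: dH.
Qed.

Lemma field_bounded : exists2 M, 0 < M & forall p, `|p| <= rho -> `|F p| <= M.
Proof.
have /ex_strict_bound_gt0[M M0 FM] : bounded_set (F @` [set p : 'rV[R]_n | `|p| <= rho]).
  apply: compact_bounded; apply: continuous_compact; last exact: compact_norm_le.
  by apply: continuous_in_subspaceT => p /set_mem; exact: F_cont.
by exists M => // p pr; apply/ltW/FM; exists p.
Qed.

Lemma trapped_lipschitz : exists2 M, 0 < M & forall x, trapped_solution x ->
  forall a b, 0 <= a -> 0 <= b -> `|x b - x a| <= M * `|b - a|.
Proof.
have [M M0 FM] := field_bounded; exists M => // x [xsol xr] a b a0 b0.
apply: norm_le_coord => [|i]; first by rewrite mulr_ge0 ?(ltW M0).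
have [c [c0 _]] := solution_MVT i xsol a0 b0.
rewrite !mxE => ->; rewrite normrM ler_wpM2r //.
by rewrite (le_trans (coord_le_norm _ _)) // FM // xr.
Qed.

(** The modulus d depends on e and on the field only, not on the solution.
Together with [taylor_solution] this characterizes the trapped solutions by
conditions which involve two values of x at a time, hence pass to pointwise
limits. *)
Lemma trapped_taylor (e : R) : 0 < e -> exists2 d, 0 < d & forall x, trapped_solution x ->
  forall a b, 0 <= a -> 0 <= b -> `|b - a| < d ->
  `|x b - x a - (b - a) *: F (x a)| <= e * `|b - a|.
Proof.
move=> e0; have [M M0 lipM] := trapped_lipschitz.
have [d d0 Fd] := field_unif_continuous e0.
exists (d / M); first by rewrite divr_gt0.
move=> x xs a b a0 b0; rewrite ltr_pdivlMr // => bad; have [xsol xr] := xs.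
apply: norm_le_coord => [|i]; first by rewrite mulr_ge0 ?(ltW e0).
have [c [c0 ca xE]] := solution_MVT i xsol a0 b0.
rewrite [_ 0 i](_ : _ = (F (x c) - F (x a)) 0 i * (b - a)); last first.
  by move: xE; rewrite !mxE => ->; ring.
rewrite normrM ler_wpM2r // (le_trans (coord_le_norm _ _)) // Fd //; first exact: xr.
rewrite (le_trans (lipM _ xs _ _ a0 c0)) // (le_trans _ (ltW bad)) //.
by rewrite mulrC ler_pM2r.
Qed.

(** The converse of [trapped_taylor]: the estimate bounds the difference quotients
on both sides of each time. *)
Lemma taylor_solution (x : R -> 'rV[R]_n) : trapped x ->
  (forall e, 0 < e -> exists2 d, 0 < d & forall a b, 0 <= a -> 0 <= b -> `|b - a| < d ->
     `|x b - x a - (b - a) *: F (x a)| <= e * `|b - a|) ->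
  trapped_solution x.
Proof.
move=> xr xT; split=> //.
have quot a e : 0 <= a -> 0 < e -> exists2 d, 0 < d & forall h, h != 0 -> 0 <= h + a -> `|h| < d ->
    `|F (x a) - h^-1 *: (x (h + a) - x a)| <= e.
  move=> a0 e0; have [d d0 H] := xT _ e0; exists d => // h h0 ha hd.
  have := H a (h + a) a0 ha; rewrite addrK => /(_ hd) {}H.
  rewrite distrC -(ler_pM2l (_ : 0 < `|h|)) ?normr_gt0 // -normrZ scalerBr scalerA divff // scale1r.
  by rewrite mulrC.
split => //.
- by move=> t t0; apply: rho_O; exact: xr.
- apply/cvgrPdist_le => e e0; have [d d0 H] := quot 0 e (lexx _) e0.
  near=> h; have := H h; rewrite !addr0; apply.
  + by rewrite gt_eqF //; near: h; exact: nbhs_right_gt.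
  + by near: h; exact: nbhs_right_ge.
  + rewrite gtr0_norm; first by near: h; exact: nbhs_right_lt.
    by near: h; exact: nbhs_right_gt.
- move=> t t0; apply/is_derive_quotientP; apply/cvgrPdist_le => e e0.
  have [d d0 H] := quot t e (ltW t0) e0.
  near=> h; apply: H.
  + by near: h; exact: nbhs_dnbhs_neq.
  + rewrite -lerBlDl sub0r ltW // (le_lt_trans (ler_norm _)) // normrN.
    by near: h; exact: dnbhs0_lt.
  + by near: h; exact: dnbhs0_lt.
Unshelve. all: by end_near. Qed.

Section Flow.
Variables (d : R) (phi : 'rV[R]_n -> R -> 'rV[R]_n).
Hypothesis phi_sol : forall p : 'rV[R]_n, `|p| < d -> is_solution O F p (phi p).
Hypothesis phi_trapped : forall p : 'rV[R]_n, `|p| < d -> trapped (phi p).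
Hypothesis phi_uniq : forall p : 'rV[R]_n, `|p| < d -> forall y, is_solution O F p y ->
  forall t, 0 <= t -> y t = phi p t.

Lemma flow0 p : `|p| < d -> phi p 0 = p.
Proof. by move=> pd; have [] := phi_sol pd. Qed.

Lemma flow_trapped_solution p : `|p| < d -> trapped_solution (phi p).
Proof. by move=> pd; split; [rewrite flow0 //; exact: phi_sol|exact: phi_trapped]. Qed.

(** Otherwise some ultrafilter G of points q converges to p while phi q t stays
outside a neighbourhood of phi p t.  By compactness phi q s converges along G
for every s >= 0; the limit psi inherits the uniform Taylor estimate, hence
solves the equation with initial value p, and uniqueness gives psi = phi p,
a contradiction at time t. *)
Lemma flow_continuous (t : R) (p : 'rV[R]_n) :
  0 <= t -> `|p| < d -> {for p, continuous (fun q => phi q t)}.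
Proof.
move=> t0 pd N Nphi; apply: contrapT => nN.
pose B := ~` [set q | N (phi q t)].
have WF : ProperFilter (within B (nbhs p)).
  apply: Build_ProperFilter => //= W.
  suff : nbhs p [set q | N (phi q t)] by [].
  rewrite /within /= in W; near=> q; apply: contrapT => Nq.
  exact: (near W q _ Nq).
have [G [GU WG]] := ultraFilterLemma WF.
have GPF : ProperFilter G by exact: ultra_proper.
have GB : G B by apply: WG; exact: withinT.
have Gp : G --> p.
  by move=> A pA; apply: WG; rewrite /within /=; near=> q => _; near: q.
have Gd : G [set q | `|q| < d].
  by apply: Gp; exact: (cvgr_lt _ (@norm_continuous _ _ p) _ pd).
have lim s : exists l, 0 <= s -> `|l| <= rho /\ phi q s @[q --> G] --> l.
  case: (lerP 0 s) => s0; last by exists 0 => /=.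
  have [|l lr lG] := compact_ultra_fmap (f := phi^~ s) GU (@compact_norm_le R n rho).
    by apply: filterS Gd => q qd; exact: phi_trapped.
  by exists l.
have [psi psiP] := choice lim.
have psir : trapped psi by move=> s s0; have [] := psiP s s0.
have psi0 : psi 0 = p.
  have [_ H] := psiP 0 (lexx _).
  apply: (norm_cvg_unique H) => A pA.
  by apply: filterS (filterI (Gp _ pA) Gd) => q [/= Aq qd]; rewrite flow0.
have psi_ts : trapped_solution psi.
  apply: taylor_solution => // e e0.
  have [c c0 H] := trapped_taylor e0; exists c => // a b a0 b0 bac.
  have [ra la] := psiP a a0; have [rb lb] := psiP b b0.
  have lF : F (phi q a) @[q --> G] --> F (psi a) by exact: (continuous_cvg _ (F_cont ra)).
  have L : `|phi q b - phi q a - (b - a) *: F (phi q a)| @[q --> G] -->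
           `|psi b - psi a - (b - a) *: F (psi a)|.
    by apply: cvg_norm; apply: cvgB; [exact: cvgB|apply: cvgZ => //; exact: cvg_cst].
  apply: (@closed_cvg _ _ _ GPF _ (fun y => y <= e * `|b - a|) _ _ _ L); first exact: closed_le.
  by apply: filterS Gd => q qd; apply: H => //; exact: flow_trapped_solution.
have psiE : psi t = phi p t.
  by apply: phi_uniq => //; have [] := psi_ts; rewrite psi0.
have [_ H] := psiP t t0; rewrite psiE in H.
have HN : G [set q | N (phi q t)] by exact: (H _ Nphi).
have /filter_ex[q [/= Bq Nq]] : G (B `&` [set q | N (phi q t)]) by exact: filterI.
exact: Bq.
Unshelve. all: by end_near. Qed.

End Flow.
End BoundedSolutions.

(** * From the field to its flow *)

Section AttractiveFlow.
Variables (R : realType) (n : nat) (O : set 'rV[R]_n) (F : 'rV[R]_n -> 'rV[R]_n).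
Variable (rho : R).
Hypothesis rho_O : forall p : 'rV[R]_n, `|p| <= rho -> O p.
Hypothesis F_cont : forall p : 'rV[R]_n, `|p| <= rho -> {for p, continuous F}.
Variables (d : R) (phi : 'rV[R]_n -> R -> 'rV[R]_n).
Hypothesis phi_sol : forall p : 'rV[R]_n, `|p| < d -> is_solution O F p (phi p).
Hypothesis phi_trapped : forall p : 'rV[R]_n, `|p| < d -> trapped rho (phi p).
Hypothesis phi_uniq : forall p : 'rV[R]_n, `|p| < d -> forall y, is_solution O F p y ->
  forall t, 0 <= t -> y t = phi p t.
Hypothesis phi_attr : forall p : 'rV[R]_n, `|p| < d -> phi p t @[t --> +oo] --> (0 : 'rV[R]_n).
Hypothesis stable : lyapunov_stable O F.

Let phi_0 (p : 'rV[R]_n) : `|p| < d -> phi p 0 = p.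
Proof. exact: (flow0 phi_sol). Qed.

(** By uniqueness an orbit which returns to p is periodic, so it keeps visiting p
and cannot tend to 0. *)
Lemma flow_no_return (p : 'rV[R]_n) (t : R) : 0 < `|p| -> `|p| < d -> 0 < t -> phi p t <> p.
Proof.
move=> p0 pd t0 pt.
have per s : 0 <= s -> phi p (s + t) = phi p s.
  move=> s0; have := solution_shift (phi_sol pd) (ltW t0); rewrite pt.
  by move=> /(phi_uniq pd)/(_ s s0).
have pk k : phi p (k%:R * t) = p.
  elim: k => [|k IH]; first by rewrite mul0r phi_0.
  by rewrite -natr1 mulrDl mul1r per // mulr_ge0 // ltW.
have /cvgr0_norm_lt/(_ _ p0) [A [_ HA]] := phi_attr pd.
have /HA : A < (Num.bound (`|A| / t))%:R * t.
  have := archi_boundP (divr_ge0 (normr_ge0 A) (ltW t0)).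
  by rewrite ltr_pdivrMr //; apply: le_lt_trans; exact: ler_norm.
by rewrite pk ltxx.
Qed.

Lemma field_neq0 (p : 'rV[R]_n) : 0 < `|p| -> `|p| < d -> F p <> 0.
Proof.
move=> p0 pd Fp.
have Op : O p by apply: rho_O; rewrite -[p](phi_0 pd); exact: phi_trapped.
apply: (flow_no_return p0 pd (@ltr01 R)).
by rewrite -(phi_uniq pd (constant_solution Op Fp)).
Qed.

(** Each orbit from the sphere enters the ball from which, by stability, it never
leaves the ball of radius r / 2; the entry time works for neighbouring
initial points too, and compactness of the sphere makes it uniform. *)
Lemma uniform_attraction (r : R) : 0 < r -> r < d ->
  exists2 T, 0 < T & forall p : 'rV[R]_n, `|p| = r -> `|phi p T| < r / 2.
Proof.
move=> r0 rd.
have r20 : 0 < r / 2 by rewrite divr_gt0.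
have /nbhs_ballP[d1 /= d10 Hd1] := stable r20.
have Sc : compact [set p : 'rV[R]_n | `|p| = r].
  apply: (subclosed_compact _ (@compact_norm_le R n r)); last by move=> p /= ->.
  by apply: (@closed_comp _ _ (@Num.norm R 'rV[R]_n) [set y | y = r]);
    [move=> y _; exact: norm_continuous|exact: closed_eq].
pose good (T : R) (p : 'rV[R]_n) := `|phi p T| < r / 2.
have H : \forall T \near +oo, [set p : 'rV[R]_n | `|p| = r] `<=` good T.
  apply: ((compact_near_coveringP _).1 Sc) => p /= pr.
  have pd : `|p| < d by rewrite pr.
  have [T T0 pT] : exists2 T, 0 <= T & `|phi p T| < d1.
    have /cvgr0_norm_lt/(_ _ d10) HA := phi_attr pd.
    have /filter_ex[T [? ?]] : \forall T \near +oo, 0 <= T /\ `|phi p T| < d1.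
      by near=> T; split; near: T => //; exact: nbhs_pinfty_ge.
    by exists T.
  exists ([set q | `|q| < d /\ `|phi q T| < d1], [set t | T <= t]) => /=; last first.
    move=> [q t] /= [[qd qT] Tt]; rewrite /good.
    have := Hd1 (phi q T); rewrite -ball_normE /= sub0r normrN => /(_ qT).
    move=> /(_ _ (solution_shift (phi_sol qd) T0))/(_ (t - T)).
    by rewrite subr_ge0 subrK => /(_ Tt).
  split; last by apply: nbhs_pinfty_ge; rewrite num_real.
  near=> q; split; near: q.
    exact: (cvgr_lt _ (@norm_continuous _ _ p) _ pd).
  have C := flow_continuous rho_O F_cont phi_sol phi_trapped phi_uniq T0 pd.
  exact: (cvgr_lt _ (continuous_comp C (@norm_continuous _ _ (phi p T))) _ pT).
have /filter_ex[T [T0 HT]] : \forall T \near +oo,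
    0 < T /\ [set p : 'rV[R]_n | `|p| = r] `<=` good T.
  by near=> T; split; near: T => //; exact: nbhs_pinfty_gt.
by exists T.
Unshelve. all: by end_near. Qed.

(** The mean velocity over [0, t]; it extends continuously to t = 0 by the field. *)
Definition velocity (p : 'rV[R]_n) (t : R) : 'rV[R]_n :=
  if t == 0 then F p else t^-1 *: (phi p t - p).

Variables (r T : R).
Hypotheses (r0 : 0 < r) (rd : r < d) (T0 : 0 < T).

(** The time attached to z: it is 0 on the ball of radius r and reaches T on the
sphere of radius 2 r. *)
Definition clock (z : 'rV[R]_n) : R := T * Num.max 0 (`|z| / r - 1).

Definition radial_velocity (z : 'rV[R]_n) := velocity (clamp r z) (clock z).

Lemma clock_ge0 (z : 'rV[R]_n) : 0 <= clock z.
Proof. by rewrite mulr_ge0 ?(ltW T0) // le_max lexx. Qed.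

Lemma continuous_clock : continuous clock.
Proof.
move=> z; apply: (@continuousM _ _ (fun=> T) (fun z : 'rV[R]_n => Num.max 0 (`|z| / r - 1))).
  exact: cst_continuous.
apply: (@continuous_max _ _ (fun=> 0) (fun z => `|z| / r - 1)); first exact: cst_continuous.
apply: (@continuousB _ _ _ (fun z : 'rV[R]_n => `|z| / r) (fun=> 1)); last exact: cst_continuous.
apply: (@continuousM _ _ (fun z : 'rV[R]_n => `|z|) (fun=> r^-1)); last exact: cst_continuous.
exact: norm_continuous.
Qed.

Lemma clock_inside (z : 'rV[R]_n) : `|z| <= r -> clock z = 0.
Proof.
move=> zr; rewrite /clock max_l ?mulr0 // subr_le0 ler_pdivrMr // mul1r.
exact: zr.
Qed.

Lemma clamp_lt (z : 'rV[R]_n) : `|clamp r z| < d.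
Proof. exact: le_lt_trans (norm_clamp_le _ r0) rd. Qed.

(** At a point with positive time this is the continuity of the flow in both
arguments.  At a point with time 0 the quotients (phi_t p - p) / t are close to
F p uniformly in p, by [trapped_taylor]. *)
Lemma continuous_radial_velocity (z : 'rV[R]_n) : {for z, continuous radial_velocity}.
Proof.
have cz := @clamp_lt z.
have [tz|tz] := eqVneq (clock z) 0.
  apply/(@cvgrPdist_le _ _ _ (nbhs z) (nbhs_filter z)) => e e0.
  have Vz : radial_velocity z = F (clamp r z) by rewrite /radial_velocity /velocity tz eqxx.
  have e20 : 0 < e / 2 by rewrite divr_gt0.
  have [c c0 Hc] := @trapped_taylor R n O F rho F_cont _ e20.
  have cF : {for z, continuous (fun z => F (clamp r z))}.
    apply: (continuous_comp (@continuous_clamp _ _ _ r0 z)); apply: F_cont.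
    by rewrite -[clamp r z](phi_0 cz); exact: phi_trapped.
  near=> w.
  have E : `|F (clamp r z) - F (clamp r w)| <= e / 2.
    by near: w; exact: (@cvgr_dist_le _ _ _ (nbhs z) _ _ _ cF _ e20).
  rewrite Vz -(subrKA (F (clamp r w))) (le_trans (ler_normD _ _)) // [leRHS]splitr lerD //.
  rewrite /radial_velocity /velocity; case: eqVneq => [tw|tw]; first by rewrite subrr normr0 ltW.
  have tw0 : 0 < clock w by rewrite lt_def tw clock_ge0.
  have := Hc _ (flow_trapped_solution phi_sol phi_trapped (@clamp_lt w))
    0 (clock w) (lexx _) (clock_ge0 w).
  rewrite subr0 gtr0_norm // phi_0 ?clamp_lt // => H.
  rewrite distrC -(ler_pM2l tw0) -{1}(gtr0_norm tw0) -normrZ scalerBr scalerA divff // scale1r.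
  rewrite mulrC; apply: H; near: w.
  by apply: (@cvgr_lt _ _ (nbhs z) _ _ _ (@continuous_clock z)); rewrite tz.
have tz0 : 0 < clock z by rewrite lt_def tz clock_ge0.
have [M M0 lip] := @trapped_lipschitz R n O F rho F_cont.
have Fl := flow_continuous rho_O F_cont phi_sol phi_trapped phi_uniq (clock_ge0 z) cz.
have C : (fun w => phi (clamp r w) (clock w)) w @[w --> z] --> phi (clamp r z) (clock z).
  apply/(@cvgrPdist_le _ _ _ (nbhs z) (nbhs_filter z)) => e e0.
  have e20 : 0 < e / 2 by rewrite divr_gt0.
  near=> w.
  rewrite -(subrKA (phi (clamp r w) (clock z))) (le_trans (ler_normD _ _)) // [leRHS]splitr lerD //.
    near: w; apply: (@cvgr_dist_le _ _ _ (nbhs z) _ (fun w => phi (clamp r w) (clock z)) _ _ _ e20).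
    exact: (continuous_comp (@continuous_clamp _ _ _ r0 z) Fl).
  rewrite (le_trans (lip _ (flow_trapped_solution phi_sol phi_trapped (@clamp_lt w))
    _ _ (clock_ge0 w) (clock_ge0 z))) //.
  rewrite -ler_pdivlMl //; near: w.
  apply: (@cvgr_dist_le _ _ _ (nbhs z) _ _ _ (@continuous_clock z)).
  by rewrite mulr_gt0 ?invr_gt0.
have : (fun w => (clock w)^-1 *: (phi (clamp r w) (clock w) - clamp r w)) w @[w --> z] -->
   (clock z)^-1 *: (phi (clamp r z) (clock z) - clamp r z).
  apply: (@continuousZ _ _ _ (fun w => (clock w)^-1)
    (fun w => phi (clamp r w) (clock w) - clamp r w) z).
    exact: (@continuousV _ _ clock z tz (@continuous_clock z)).
  apply: (@continuousB _ _ _ (fun w => phi (clamp r w) (clock w)) (clamp r)); first exact: C.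
  exact: continuous_clamp.
have -> : (clock z)^-1 *: (phi (clamp r z) (clock z) - clamp r z) = radial_velocity z.
  by rewrite /radial_velocity /velocity (negPf tz).
move=> L; apply: (cvg_trans _ L); apply: (@near_eq_cvg _ _ (nbhs z)).
near=> w; rewrite /radial_velocity /velocity.
have tw : 0 < clock w by near: w; exact: (@cvgr_gt _ _ (nbhs z) _ _ _ (@continuous_clock z)).
by rewrite gt_eqF.
Unshelve. all: by end_near. Qed.

(** A zero in the shell is either an equilibrium or a closed orbit. *)
Lemma radial_velocity_neq0 (z : 'rV[R]_n) : r <= `|z| -> radial_velocity z <> 0.
Proof.
move=> rz; have cr := norm_clamp_ge r0 rz.
have c0 : 0 < `|clamp r z| by rewrite cr.
rewrite /radial_velocity /velocity; case: eqVneq => [_|tz].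
  by apply: field_neq0 => //; exact: clamp_lt.
move=> /eqP; rewrite scaler_eq0 invr_eq0 (negPf tz) /= subr_eq0 => /eqP.
apply: flow_no_return => //; first exact: clamp_lt.
by rewrite lt_def tz clock_ge0.
Qed.

Hypothesis T_contracts : forall p : 'rV[R]_n, `|p| = r -> `|phi p T| < r / 2.

(** On the sphere |z| = 2 r, with p = z / 2, the equation V z - y = l z would read
phi_T p - T y = (1 + 2 l T) p.  The left side has norm less than
r / 2 + r / 2 if |y| < r / (2 T), the right side has norm at least r. *)
Lemma ball_image_nbhs : exists2 c, 0 < c &
  forall y : 'rV[R]_n, `|y| < c -> exists2 x, `|x| <= r & F x = y.
Proof.
pose A := [set z : 'rV[R]_n | r <= `|z| /\ `|z| <= 2 * r].
have [c1 c10 Hc1] : exists2 c1, 0 < c1 & forall z, A z -> c1 <= `|radial_velocity z|.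
  have [A0|A0] := pselect (A !=set0); last first.
    by exists 1 => // z Az; case: A0; exists z.
  have Ac : compact A.
    apply: (subclosed_compact _ (@compact_norm_le R n (2 * r))); last by move=> p [].
    apply: closedI.
      apply: (@closed_comp _ _ (@Num.norm R 'rV[R]_n) [set y | r <= y]);
        [by move=> y _; exact: norm_continuous|exact: closed_ge].
    apply: (@closed_comp _ _ (@Num.norm R 'rV[R]_n) [set y | y <= 2 * r]);
        [by move=> y _; exact: norm_continuous|exact: closed_le].
  have [|z /set_mem [rz _] Hz] := EVT_min_rV (f := fun z => `|radial_velocity z|) A0 Ac.
    apply: continuous_subspaceT => z.
    exact: (continuous_comp (@continuous_radial_velocity z)
      (@norm_continuous _ _ (radial_velocity z))).
  exists `|radial_velocity z|; first by rewrite normr_gt0; apply/eqP/radial_velocity_neq0.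
  by move=> w Aw; apply: Hz; exact: mem_set.
exists (Num.min c1 (r / (2 * T))).
  by rewrite lt_min c10 divr_gt0 ?mulr_gt0.
move=> y; rewrite lt_min => /andP[yc1 yT].
have r20 : 0 < 2 * r by rewrite mulr_gt0.
have [|z l z2r l0|z zr] := @poincare_bohl R n (2 * r) (fun z => radial_velocity z - y) r20.
- move=> z; apply: (@continuousB _ _ _ radial_velocity (fun=> y)); last exact: cst_continuous.
  exact: continuous_radial_velocity.
- have zE : z = 2 *: clamp r z.
    rewrite /clamp z2r max_r; last by rewrite ler_peMl ?(ltW r0) // ler1n.
    rewrite scalerA (_ : 2 * _ = 1) ?scale1r //; field.
    by rewrite gt_eqF.
  have cr : `|clamp r z| = r by rewrite norm_clamp_ge // z2r ler_peMl ?(ltW r0) // ler1n.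
  have tz : clock z = T.
    rewrite /clock z2r mulfK ?gt_eqF // max_r; first by ring.
    by rewrite subr_ge0 ler1n.
  rewrite /radial_velocity /velocity tz gt_eqF //.
  move: zE cr; move: (clamp r z) => p zE cr H; rewrite zE in H.
  have pE : phi p T - T *: y = (1 + 2 * l * T) *: p.
    apply/rowP => i; have := congr1 (fun v : 'rV[R]_n => v 0 i) H; rewrite !mxE => E.
    have -> : phi p T 0 i = p 0 i + T * (l * (2 * p 0 i) + y 0 i).
      by rewrite -E; field; rewrite gt_eqF.
    by ring.
  have : `|phi p T - T *: y| < r.
    rewrite (le_lt_trans (ler_normB _ _)) // [ltRHS]splitr ltrD //; first exact: T_contracts.
    rewrite normrZ gtr0_norm // mulrC -ltr_pdivlMr //; apply: lt_le_trans yT _.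
    by rewrite invfM mulrA.
  rewrite pE normrZ cr gtr_pMl // ltNge; move/negP; apply.
  have lT : 0 <= 2 * l * T by rewrite !mulr_ge0 // ltW.
  by rewrite ger0_norm ?lerDl // addr_ge0.
move=> /eqP; rewrite subr_eq0 => /eqP zy.
have zltr : `|z| < r.
  rewrite ltNge; apply/negP => rz; have := Hc1 z (conj rz zr).
  by rewrite zy leNgt yc1.
exists z; first exact: ltW.
move: zy; rewrite /radial_velocity /velocity clock_inside ?(ltW zltr) // eqxx clamp_id //.
exact: ltW.
Qed.

End AttractiveFlow.

(** * Stabilization and openness *)

Lemma nbhs0_ballP (R : realType) (V : normedModType R) (A : set V) :
  nbhs 0 A <-> exists2 e : R, 0 < e & forall p, `|p| < e -> A p.
Proof.
split=> [/nbhs_ballP[e /= e0 eA]|[e e0 eA]].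
  by exists e => // p pe; apply: eA; rewrite -ball_normE /= sub0r normrN.
apply/nbhs_ballP; exists e => // p; rewrite -ball_normE /= sub0r normrN.
exact: eA.
Qed.

(** All the data of the flow are restricted to one small ball on which solutions
exist, are unique, converge to 0 and remain where F is continuous. *)
Theorem asymptotically_stable_open (R : realType) (n : nat) (O : set 'rV[R]_n)
    (F : 'rV[R]_n -> 'rV[R]_n) :
  nbhs (0 : 'rV[R]_n) O -> {within O, continuous F} -> uniquely_solvable O F ->
  locally_asymptotically_stable O F -> open_at O F 0.
Proof.
move=> O0 Fc usolv [F0 stab attr] W W0; rewrite F0.
have /nbhs0_ballP[e e0 eWO] : nbhs (0 : 'rV[R]_n) (W `&` O) by exact: filterI.
pose rho := e / 2.
have rho0 : 0 < rho by rewrite divr_gt0.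
have rhoe : rho < e by rewrite /rho; lra.
have rho_O p : `|p| <= rho -> O p.
  by move=> pr; have [] := eWO p (le_lt_trans pr rhoe).
have F_cont p : `|p| <= rho -> {for p, continuous F}.
  move=> pr; have Oint : (O°)%classic p.
    apply: (@filterS _ (nbhs p) _ [set q | `|q| < e]); first by move=> q /eWO[].
    exact: (@cvgr_lt _ _ (nbhs p) _ _ _ (@norm_continuous _ _ p) _ (le_lt_trans pr rhoe)).
  by have := Fc p; rewrite /continuous_at -nbhs_subspace_interior.
have : nbhs (0 : 'rV[R]_n) [set p | [/\ exists2 x : R -> 'rV[R]_n, is_solution O F p x &
      forall y : R -> 'rV[R]_n, is_solution O F p y ->
        forall t : R, 0 <= t -> y t = x t,
    forall x, is_solution O F p x -> forall t : R, 0 <= t -> `|x t| < rho &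
    forall x, is_solution O F p x -> x t @[t --> +oo] --> (0 : 'rV[R]_n)]].
  by apply: filterS3 usolv (stab _ rho0) attr => p H1 H2 H3; split.
move=> /nbhs0_ballP[d d0 Hd].
have : forall p, exists x : R -> 'rV[R]_n, `|p| < d -> is_solution O F p x /\
    forall y, is_solution O F p y -> forall t : R, 0 <= t -> y t = x t.
  move=> p; have [/Hd[[x xs xu] _ _]|] := ltP `|p| d; first by exists x.
  by exists (fun=> 0).
move=> /choice[phi Hphi].
have phi_sol p : `|p| < d -> is_solution O F p (phi p) by move=> /Hphi[].
pose r := Num.min d rho / 2.
have r0 : 0 < r by rewrite divr_gt0 // lt_min d0.
have r2 : r + r = Num.min d rho by rewrite -splitr.
have [rd rrho] : r < d /\ r < rho.
  by split; [apply: (@lt_le_trans _ _ (Num.min d rho))|apply: (@lt_le_trans _ _ (Num.min d rho))];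
    rewrite -?r2 ?ltrDl // r2 ge_min lexx ?orbT.
have phi_trapped p : `|p| < d -> trapped rho (phi p).
  by move=> pd t t0; have [_ H _] := Hd _ pd; apply/ltW/H => //; exact: phi_sol.
have phi_uniq p : `|p| < d -> forall y, is_solution O F p y -> forall t, 0 <= t -> y t = phi p t.
  by move=> /Hphi[].
have phi_attr p : `|p| < d -> phi p t @[t --> +oo] --> (0 : 'rV[R]_n).
  by move=> pd; have [_ _ H] := Hd _ pd; apply: H; exact: phi_sol.
have [T T0 HT] := uniform_attraction rho_O F_cont phi_sol phi_trapped phi_uniq phi_attr stab r0 rd.
have [c c0 Hc] := ball_image_nbhs rho_O F_cont phi_sol phi_trapped phi_uniq phi_attr r0 rd T0 HT.
apply/nbhs0_ballP; exists c => // y /Hc[x xr <-]; exists x => //.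
by apply: eWO; apply: le_lt_trans xr (lt_trans rrho rhoe).
Qed.

Section LinearDecay.
Variables (R : realType) (n : nat) (d : R) (F : 'rV[R]_n -> 'rV[R]_n).
Let O : set 'rV[R]_n := [set p | `|p| < d].
Hypothesis FN : forall p, O p -> F p = - p.

Lemma decay_solution (p : 'rV[R]_n) : O p -> is_solution O F p (fun t => expR (- t) *: p).
Proof.
move=> Op.
have Ot (t : R) : 0 <= t -> O (expR (- t) *: p).
  move=> t0; rewrite /O /= normrZ ger0_norm ?expR_ge0 //; apply: le_lt_trans Op.
  by rewrite ler_piMl // expR_le1 oppr_le0.
have D (t : R) : 0 <= t -> is_derive t 1 (fun t => expR (- t) *: p) (F (expR (- t) *: p)).
  move=> t0; rewrite FN; last exact: Ot.
  have /is_derive_quotientP E : is_derive t 1 (fun t : R => expR (- t)) (- expR (- t)).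
    by apply: is_derive_eq; rewrite /GRing.scale /= mulrN1.
  apply: (is_derive_quotientP (fun t => expR (- t) *: p) t _).2; rewrite -scaleNr /=.
  have L : (h^-1 * (expR (- (h + t)) - expR (- t))) *: p @[h --> (0 : R)^'] --> (- expR (- t)) *: p.
    by apply: cvgZ; [exact: E|exact: cvg_cst].
  apply: cvg_trans L; apply: near_eq_cvg; apply: nearW => h /=.
  by rewrite -scalerDl scalerA.
split.
- by rewrite oppr0 expR0 scale1r.
- exact: Ot.
- have /is_derive_quotientP/cvg_dnbhs_at_right := D 0 (lexx _).
  apply: cvg_trans; apply: near_eq_cvg; apply: nearW => h /=.
  by rewrite addr0.
- by move=> t /ltW; exact: D.
Qed.

(** The product expR s * y s has derivative 0. *)
Lemma decay_unique (p : 'rV[R]_n) (y : R -> 'rV[R]_n) : is_solution O F p y ->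
  forall t, 0 <= t -> y t = expR (- t) *: p.
Proof.
move=> ys t; rewrite le_eqVlt => /orP[/eqP<-|t0].
  by have [-> _ _ _] := ys; rewrite oppr0 expR0 scale1r.
have [y0 yO _ dy] := ys.
apply/rowP => i; rewrite mxE.
have [s||c _] := @MVT R (fun s => expR s * y s 0 i) (fun=> 0) 0 t t0.
- rewrite in_itv /= => /andP[s0 _].
  have D := coord_is_derive i (dy s s0).
  have := is_deriveM (is_derive_expR s) D.
  by rewrite FN ?mxE; [|exact/yO/ltW]; move=> /is_derive_eq; apply; rewrite /GRing.scale /=; ring.
- move=> s; apply: (@continuousM _ (subspace `[0, t]) expR (fun s => y s 0 i) s).
    exact: (@continuous_subspaceT _ _ _ _ (@continuous_expR R)).
  exact: (solution_coord_continuous ys (lexx 0) t0).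
rewrite mul0r expR0 mul1r y0 => /eqP; rewrite subr_eq0 => /eqP <-.
by rewrite mulrA -expRD addrC subrr expR0 mul1r.
Qed.

Lemma decay_asymptotically_stable : 0 < d ->
  uniquely_solvable O F /\ locally_asymptotically_stable O F.
Proof.
move=> d0; split; last split.
- apply/nbhs0_ballP; exists d => // p pd.
  by exists (fun t => expR (- t) *: p); [exact: decay_solution|exact: decay_unique].
- by rewrite FN ?oppr0 // /O /= normr0.
- move=> e e0; apply/nbhs0_ballP; exists e => // p pe x /decay_unique xE t t0.
  rewrite xE // normrZ ger0_norm ?expR_ge0 //; apply: le_lt_trans pe.
  by rewrite ler_piMl // expR_le1 oppr_le0.
- apply/nbhs0_ballP; exists d => // p pe x /decay_unique xE.
  have L : expR (- t) *: p @[t --> +oo] --> (0 : R) *: p.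
    by apply: cvgZ; [exact: cvgr_expR|exact: cvg_cst].
  rewrite scale0r in L; apply: cvg_trans L; apply: near_eq_cvg.
  by near=> t; rewrite xE.
Unshelve. all: by end_near. Qed.

End LinearDecay.

(** The error term |y| allows a preimage of almost minimal norm to be taken when
the minimum is not attained; at y = 0 the exact choice 0 is available, so
that g 0 = 0. *)
Lemma near_minimal_section (R : realType) (V W : normedModType R) (D : set V) (f : V -> W) :
  D 0 -> f 0 = 0 ->
  exists g : W -> V, forall y, (f @` D) y ->
    [/\ D (g y), f (g y) = y & forall z, D z -> f z = y -> `|g y| <= `|z| + `|y|].
Proof.
move=> D0 f0.
suff /choice[g Hg] : forall y, exists z, (f @` D) y ->
    [/\ D z, f z = y & forall w, D w -> f w = y -> `|z| <= `|w| + `|y|] by exists g.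
move=> y.
have [[w Dw fw]|] := pselect ((f @` D) y); last by exists 0.
have [y0|y0] := eqVneq y 0.
  by exists 0 => _; rewrite y0; split => // z Dz _; rewrite !normr0 addr0.
pose A := [set a | exists z, [/\ D z, f z = y & a = `|z|]].
have A_inf : has_inf A.
  by split; [exists `|w|, w|exists 0 => a [z [_ _ ->]]].
have [|a [z [Dz fz ->]] za] := @inf_adherent _ A `|y| _ A_inf; first by rewrite normr_gt0.
exists z => _; split => // v Dv fv; apply/ltW/(lt_le_trans za); rewrite lerD2r.
by apply: ge_inf; [exact: A_inf.2|exists v].
Qed.

Theorem corollary4p12 (R : realType) (n m : nat)
    (X : set 'rV[R]_n) (U : set 'rV[R]_m)
    (f : 'rV[R]_n * 'rV[R]_m -> 'rV[R]_n)
    (nbhsXU : nbhs ((0, 0) : 'rV[R]_n * 'rV[R]_m) (X `*` U))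
    (f_cont : {within X `*` U, continuous f})
    (f00 : f (0, 0) = 0)
    (f_iso : isolated_equilibrium X U f) :
  (exists (O : set 'rV[R]_n) (h : 'rV[R]_n -> 'rV[R]_n * 'rV[R]_m),
     [/\ stabilizes X U f O h,
         stationary h &
         {for (0 : 'rV[R]_n), continuous h}]) <->
  open_at (X `*` U) f (0, 0).
Proof.
split=> [|f_open].
  move=> [ O [h [ [ O0 _ hXU hc [usolv las]] h0 hcont]]] V V0.
  have W0 : nbhs (0 : 'rV[R]_n) [set x | V (h x)].
    by apply: hcont; rewrite h0.
  have := asymptotically_stable_open O0 hc usolv las W0.
  rewrite {2}/composition_operator /= h0 f00 /interior /=.
  apply: filterS => _ [x [Vx Ox] <-]; exists (h x) => //.
  by split; [exact: Vx|exact: hXU].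
have XU0 : (X `*` U) 0 by exact: nbhs_singleton.
have [g Hg] := @near_minimal_section R _ _ (X `*` U) f XU0 f00.
have X0 : nbhs (0 : 'rV[R]_n) X.
  have [[A B] /= [A0 B0] AB] := nbhsXU; apply: filterS A0 => x Ax.
  by have [] := AB (x, 0) (conj Ax (nbhs_singleton B0)).
have im0 (e : R) : 0 < e -> exists2 c, 0 < c & forall y : 'rV[R]_n, `|y| < c ->
    exists z, [/\ (X `*` U) z, f z = y & `|z| < e].
  move=> e0; have : nbhs ((0, 0) : 'rV[R]_n * 'rV[R]_m) [set z | `|z| < e].
    by apply/(@nbhs0_ballP R ('rV[R]_n * 'rV[R]_m)%type); exists e.
  move=> /f_open; rewrite f00 => /nbhs0_ballP[c c0 Hc]; exists c => // y /Hc[z [ze Dz] fz].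
  by exists z.
have [c1 c10 Hc1] := im0 1 ltr01.
have /nbhs0_ballP[c2 c20 Hc2] := X0.
pose d := Num.min c1 c2.
have d0 : 0 < d by rewrite lt_min c10.
pose O : set 'rV[R]_n := [set p | `|p| < d].
have img (p : 'rV[R]_n) : O p -> (f @` (X `*` U)) (- p).
  rewrite /O /= lt_min -normrN => /andP[/Hc1[z [Dz fz _]] _]; by exists z.
have FN (p : 'rV[R]_n) : O p -> composition_operator (fun p => g (- p)) f p = - p.
  by move=> /img /Hg[].
exists O, (fun p => g (- p)).
have g0 : g 0 = (0, 0).
  have [|_ _ /(_ 0 XU0 f00)] := Hg 0; first by exists 0.
  by rewrite !normr0 addr0 normr_le0 => /eqP.
split; last 1 first.
- apply/(@cvgrPdist_lt _ _ _ (nbhs (0 : 'rV[R]_n)) _) => e e0.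
  rewrite oppr0 g0.
  have e20 : 0 < e / 2 by rewrite divr_gt0.
  have [c c0 Hc] := im0 _ e20.
  apply/(@nbhs0_ballP R 'rV[R]_n); exists (Num.min d (Num.min c (e / 2))).
    by rewrite lt_min d0 lt_min c0.
  move=> p; rewrite lt_min => /andP[pd]; rewrite lt_min => /andP[pc pe].
  have [_ _ H] := Hg _ (img p pd).
  have [z [Dz fz ze]] : exists z, [/\ (X `*` U) z, f z = - p & `|z| < e / 2].
    by apply: Hc; rewrite normrN.
  rewrite sub0r normrN; apply: le_lt_trans (H z Dz fz) _.
  by rewrite [ltRHS]splitr ltrD // normrN.
- split.
  + by apply/nbhs0_ballP; exists d.
  + by move=> p; rewrite /O /= lt_min => /andP[_ /Hc2].
  + by move=> p /img /Hg[].
  + apply: (@subspace_eq_continuous _ O _ (fun p => - p)).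
      by move=> p /set_mem Op; exact: (esym (FN p Op)).
    by apply: continuous_subspaceT => p; exact: (@continuousN _ _ _ id).
  + exact: decay_asymptotically_stable FN d0.
- by rewrite /stationary oppr0.
Qed.
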